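(* Let $N\ge1$ and let $T:M(N)\to M(N)$ be a non-zero linear map. Then there exists a non-zero orthogonal projection $P\in M(N)$ such that $$\frac{\|T\|_{2\to2}}{8\sqrt{4\log(48h(T)^2)+2}}<\frac{\|T(P)\|_2}{\|P\|_2}\le\|T\|_{2\to2}.$$
   Context: $M(N)$ is the space of $N\times N$ complex matrices. $\|A\|_p$ is the Schatten-$p$ norm for $1\le p<\infty$ and $\|A\|_\infty$ the operator norm; $\|T\|_{p\to p}=\sup_{X\ne0}\|T(X)\|_p/\|X\|_p$. The height of a non-zero linear map is $h(T)=\sqrt{\|T\|_{1\to1}\|T\|_{\infty\to\infty}}/\|T\|_{2\to2}$. *)

(* Defs.v *)
From HB Require Import structures.
From mathcomp Require Import all_boot all_order all_algebra.
From mathcomp Require Import boolp classical_sets reals exp.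
From mathcomp Require Export complex spectral.
Set Implicit Arguments. Unset Strict Implicit. Unset Printing Implicit Defensive.
Import Order.TTheory GRing.Theory Num.Theory.
Local Open Scope ring_scope.
Local Open Scope sesquilinear_scope.
Local Open Scope classical_set_scope.

Definition adjmx (R : realType) (N : nat) (A : 'M[R[i]]_N) : 'M[R[i]]_N := A ^t*.

(* Singular values of A: square roots of the eigenvalues of A^* A
   (A^* A is hermitian, so spectral_diag lists its eigenvalues, which are
   real and non-negative). *)
Definition singval (R : realType) (N : nat) (A : 'M[R[i]]_N) (i : 'I_N) : R :=
  Num.sqrt (complex.Re (spectral_diag (adjmx A *m A) 0 i)).

Definition schatten1 (R : realType) (N : nat) (A : 'M[R[i]]_N) : R :=
  \sum_(i < N) singval A i.
Definition schatten2 (R : realType) (N : nat) (A : 'M[R[i]]_N) : R :=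
  Num.sqrt (\sum_(i < N) singval A i ^+ 2).
Definition schattenInf (R : realType) (N : nat) (A : 'M[R[i]]_N) : R :=
  \big[Num.max/0]_(i < N) singval A i.

Definition opnorm (R : realType) (N : nat) (nrm : 'M[R[i]]_N -> R)
    (T : 'M[R[i]]_N -> 'M[R[i]]_N) : R :=
  sup [set r : R | exists X : 'M[R[i]]_N, X != 0 /\ r = nrm (T X) / nrm X].

Definition height (R : realType) (N : nat) (T : 'M[R[i]]_N -> 'M[R[i]]_N) : R :=
  Num.sqrt (opnorm (@schatten1 R N) T * opnorm (@schattenInf R N) T)
  / opnorm (@schatten2 R N) T.

(* Main.v *)
Require Import Defs.
From HB Require Import structures.
From mathcomp Require Import all_boot all_order all_algebra.
From mathcomp Require Import boolp classical_sets reals exp complex spectral.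
From mathcomp Require Import ring lra.
Set Implicit Arguments. Unset Strict Implicit. Unset Printing Implicit Defensive.
Import Order.TTheory GRing.Theory Num.Theory.
Local Open Scope ring_scope.

(** Suppose [|T P|_2 <= c |P|_2] for every orthogonal projection [P].
    For hermitian [X = sum_i x_i E_i] and [Y = sum_j y_j F_j], with [E_i], [F_j]
    rank-one spectral projections, the real numbers [b_ij = Re <T E_i, F_j>] have
    row sums at most [|T|_(1->1)] and column sums at most [|T|_(oo->oo)].
    Hence the terms of [Re <T X, Y> = sum_ij x_i y_j b_ij] in which
    [|y_j| / |x_i|] lies outside a window of ratio [O(h(T)^2)] contribute only a
    small multiple of [|T|_(2->2)].  Group the remaining terms by the dyadic
    level of [|x_i|]: on one level, [|x_i|] is constant up to a factor [2] and
    the hypothesis on projections applies, while a given [y_j] meets only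
    [O(log h(T)^2)] levels, so Cauchy-Schwarz over the levels costs a factor
    [sqrt (log h(T)^2)].  Splitting general [X] and [Y] into real and imaginary
    parts loses a factor [2], and the outcome is that [c] is not too small.
    That [h(T)] is bounded below comes from the Schur test applied to [b_ij]. *)

(** * Bilinear forms with bounded row and column sums *)

(** Cauchy-Schwarz, from Lagrange's identity: the defect [s * t - p ^+ 2] is half a sum of
    squares. *)
Lemma sum_mul_le_sqrt (R : rcfType) (I : finType) (a b : I -> R) :
  \sum_i a i * b i <=
    Num.sqrt (\sum_i a i ^+ 2) * Num.sqrt (\sum_i b i ^+ 2).
Proof.
set s := \sum_i a i ^+ 2; set t := \sum_i b i ^+ 2; set p := \sum_i _.
have s0 : 0 <= s by apply: sumr_ge0 => i _; exact: sqr_ge0.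
have lagrange : \sum_i \sum_j (a i * b j - a j * b i) ^+ 2
    = 2 * (s * t - p ^+ 2).
  have -> : 2 * (s * t - p ^+ 2) = s * t + t * s - 2 * (p * p) by ring.
  rewrite /s /t /p !big_distrlr mulr_sumr -big_split -sumrB /=.
  apply: eq_bigr => i _; rewrite mulr_sumr -big_split -sumrB /=.
  by apply: eq_bigr => j _; ring.
have pst : p ^+ 2 <= s * t.
  have : 0 <= \sum_i \sum_j (a i * b j - a j * b i) ^+ 2.
    by do 2![apply: sumr_ge0 => ? _]; exact: sqr_ge0.
  by rewrite lagrange pmulr_rge0 // subr_ge0.
by rewrite -sqrtrM // (le_trans (ler_norm p)) // -sqrtr_sqr ler_wsqrtr.
Qed.

(** The indicator is [g k - g (n + k)] for the 0/1 sequence [g], so the sum telescopes and is at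
    most the sum of the first [n] values of [g]. This bounds how many dyadic levels one number can
    meet. *)
Lemma sum_window_le (R : realFieldType) (t y : R) (n K : nat) : 0 < t ->
  \sum_(k < K) (((t * 2 ^+ k <= y)%R && (y < t * 2 ^+ (k + n))%R)%:R : R) <= n%:R.
Proof.
move=> t0; pose g (k : nat) : R := (t * 2 ^+ k <= y)%R%:R.
have g01 k : 0 <= g k <= 1 by rewrite /g ler0n lern1 leq_b1.
have gK (k : nat) : ((t * 2 ^+ k <= y)%R && (y < t * 2 ^+ (k + n))%R)%:R
    = g k - g (n + k)%N.
  rewrite /g addnC; case: (leP (t * 2 ^+ (n + k)) y) => [le_y|_] /=.
    rewrite andbF (le_trans _ le_y) ?subrr // ler_pM2l // ler_weXn2l ?leq_addl //.
    by rewrite ler1n.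
  by rewrite andbT subr0.
under eq_bigr do rewrite gK.
have split_at m m' : \sum_(k < m + m') g k
    = \sum_(k < m) g k + \sum_(k < m') g (m + k)%N.
  by rewrite big_split_ord.
have : \sum_(k < K) g k + \sum_(k < n) g (K + k)%N
    = \sum_(k < n) g k + \sum_(k < K) g (n + k)%N.
  by rewrite -!split_at addnC.
have : \sum_(k < n) g k <= n%:R.
  rewrite -[n in n%:R]card_ord -sum1_card natr_sum; apply: ler_sum => k _.
  by case/andP: (g01 k).
have : 0 <= \sum_(k < n) g (K + k)%N.
  by apply: sumr_ge0 => k _; case/andP: (g01 (K + k)%N).
by rewrite sumrB; lra.
Qed.

Lemma dyadic_range (R : archiRealFieldType) (I : finType) (x : I -> R) :
  exists (a : R) (K : nat), 0 < a /\
    forall i, x i != 0 -> a <= `|x i| < a * 2 ^+ K.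
Proof.
(* Zero entries add nothing to [s], their inverse being 0, and the summand 1 keeps [s] positive even
   when no entry is non-zero. *)
pose s := 1 + \sum_i `|x i|^-1; pose u := \sum_i `|x i|.
have s1 : 0 < s.
  by rewrite ltr_pwDl // sumr_ge0 // => i _; rewrite invr_ge0.
have s0 := lt0r_neq0 s1.
exists s^-1, (Num.bound (u * s)); split=> [|i xi]; first by rewrite invr_gt0.
have xi0 : 0 < `|x i| by rewrite normr_gt0.
apply/andP; split.
  rewrite -[X in _ <= X]invrK lef_pV2 ?posrE ?invr_gt0 //.
  rewrite /s (bigD1 i) //= addrCA lerDl addr_ge0 // sumr_ge0 // => j _.
  by rewrite invr_ge0.
have us : `|x i| <= u by rewrite /u (bigD1 i) //= lerDl sumr_ge0.
rewrite mulrC ltr_pdivlMr //.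
apply: le_lt_trans (_ : u * s < _); first by rewrite ler_pM2r.
apply: lt_le_trans (archi_boundP _) _.
  by rewrite mulr_ge0 // ?(ltW s1) // (le_trans _ us).
by rewrite -natrX ler_nat ltnW // ltn_expl.
Qed.

Lemma dyadic_level (R : realFieldType) (a x : R) (K : nat) :
  a <= x < a * 2 ^+ K ->
  exists k : 'I_K, (a * 2 ^+ k <= x) && (x < a * 2 ^+ k.+1).
Proof.
move=> /andP[ax]; elim: K => [|K IH].
  by rewrite expr0 mulr1 => /(le_lt_trans ax); rewrite ltxx.
have [/IH[k kP] _|Kx xK] := ltP x (a * 2 ^+ K).
  by exists (widen_ord (leqnSn K) k).
by exists ord_max; rewrite /= Kx xK.
Qed.

Section BilinearBound.
Variables (R : realType) (I J : finType) (b : I -> J -> R).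
Variables (al be : R).
Hypothesis row_sum : forall i, \sum_j `|b i j| <= al.
Hypothesis col_sum : forall j, \sum_i `|b i j| <= be.

(** Pays for the terms outside the windows: the [x] part uses the row sums, the [y] part, after
    exchanging the sums, the column sums. *)
Lemma sum_weights_le (e d : R) (x : I -> R) (y : J -> R) : 0 <= e -> 0 <= d ->
  \sum_i \sum_j `|b i j| * (e * x i ^+ 2 + d * y j ^+ 2)
    <= e * al * (\sum_i x i ^+ 2) + d * be * (\sum_j y j ^+ 2).
Proof.
move=> e0 d0.
under eq_bigr do under eq_bigr do rewrite mulrDr.
under eq_bigr do rewrite big_split /=.
rewrite big_split /= lerD //.
  rewrite mulr_sumr; apply: ler_sum => i _.
  rewrite -mulr_suml mulrC mulrAC.
  by rewrite ler_wpM2r ?sqr_ge0 // ler_wpM2l.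
rewrite exchange_big /= mulr_sumr; apply: ler_sum => j _.
rewrite -mulr_suml mulrC mulrAC.
by rewrite ler_wpM2r ?sqr_ge0 // ler_wpM2l.
Qed.

(** Termwise weighted arithmetic-geometric inequality; the free [t] later balances [al] against
    [be]. *)
Lemma schur_test (t : R) (x : I -> R) (y : J -> R) : 0 < t ->
  \sum_i \sum_j x i * y j * b i j
    <= t / 2 * al * (\sum_i x i ^+ 2) + t^-1 / 2 * be * (\sum_j y j ^+ 2).
Proof.
move=> t0; have ti0 : 0 < t^-1 by rewrite invr_gt0.
apply: le_trans (sum_weights_le _ _ _ _); try lra.
apply: ler_sum => i _; apply: ler_sum => j _.
rewrite (le_trans (ler_norm _)) // 2!normrM mulrC ler_wpM2l //.
rewrite -(real_normK (num_real (x i))) -(real_normK (num_real (y j))).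
set u := `|x i|; set v := `|y j|.
rewrite -subr_ge0.
suff -> : t / 2 * u ^+ 2 + t^-1 / 2 * v ^+ 2 - u * v
    = t / 2 * (u - t^-1 * v) ^+ 2 by rewrite mulr_ge0 ?sqr_ge0 //; lra.
by field; rewrite lt0r_neq0.
Qed.

Variable c : R.
Hypothesis c0 : 0 <= c.
Hypothesis restricted : forall (S : {set I}) (y : J -> R),
  \sum_(i in S) \sum_j b i j * y j
    <= c * Num.sqrt #|S|%:R * Num.sqrt (\sum_j y j ^+ 2).

(** Split [S] by the sign of the inner sum and test the negative part against [- y]; the factor
    [Num.sqrt 2] is the cost of adding the square roots of the two cardinals. *)
Lemma sum_norm_le (S : {set I}) (y : J -> R) :
  \sum_(i in S) `|\sum_j b i j * y j|
    <= c * Num.sqrt 2 * Num.sqrt #|S|%:R * Num.sqrt (\sum_j y j ^+ 2).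
Proof.
pose g i := \sum_j b i j * y j; set Y := Num.sqrt (\sum_j _).
have Y0 : 0 <= Y := sqrtr_ge0 _.
pose S1 := S :&: [set i | 0 <= g i]; pose S2 := S :\: [set i | 0 <= g i].
have -> : \sum_(i in S) `|g i| = \sum_(i in S1) g i + \sum_(i in S2) - g i.
  rewrite (big_setID [set i | 0 <= g i]) /=; congr (_ + _).
    by apply: eq_bigr => i; rewrite !inE => /andP[_ /ger0_norm].
  by apply: eq_bigr => i; rewrite !inE -ltNge => /andP[/ltr0_norm].
have le1 : \sum_(i in S1) g i <= c * Num.sqrt #|S1|%:R * Y by exact: restricted.
have le2 : \sum_(i in S2) - g i <= c * Num.sqrt #|S2|%:R * Y.
  have := restricted S2 (fun j => - y j).
  have -> : \sum_j (- y j) ^+ 2 = \sum_j y j ^+ 2.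
    by apply: eq_bigr => j _; rewrite sqrrN.
  by under eq_bigr => i _ do (under eq_bigr do rewrite mulrN; rewrite sumrN).
apply: le_trans (lerD le1 le2) _.
rewrite -mulrDl -mulrDr ler_wpM2r // -mulrA ler_wpM2l //.
rewrite -sqrtrM // -[X in _ * X%:R](cardsID [set i | 0 <= g i] S) natrD.
rewrite -/S1 -/S2; set p := #|S1|%:R; set q := #|S2|%:R.
have p0 : 0 <= p :> R by exact: ler0n.
have q0 : 0 <= q :> R by exact: ler0n.
have := sqr_sqrtr p0; have := sqr_sqrtr q0.
set u := Num.sqrt p; set v := Num.sqrt q => v2 u2.
have -> : u + v = Num.sqrt ((u + v) ^+ 2).
  by rewrite sqrtr_sqr ger0_norm // addr_ge0 // sqrtr_ge0.
rewrite ler_wsqrtr // -u2 -v2 -subr_ge0.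
suff -> : 2 * (u ^+ 2 + v ^+ 2) - (u + v) ^+ 2 = (u - v) ^+ 2 by exact: sqr_ge0.
by ring.
Qed.

(** The parameters [e] and [d] fix the two ends of the window of ratios, and [2 <= e * d * 2 ^+ n]
    ensures that a given [y j] meets at most [n] levels. In the last term, 2 comes from rounding
    [x i] up to the top of its level, [Num.sqrt 2] from the sign split, and [Num.sqrt n%:R] from
    Cauchy-Schwarz over the levels. *)
Lemma bilinear_bound (e d : R) (n : nat) (x : I -> R) (y : J -> R) :
  0 < e -> 0 < d -> 2 <= e * d * 2 ^+ n ->
  \sum_i \sum_j x i * y j * b i j
    <= e * al * (\sum_i x i ^+ 2) + d * be * (\sum_j y j ^+ 2)
       + c * (2 * Num.sqrt 2) * Num.sqrt n%:R
         * (Num.sqrt (\sum_i x i ^+ 2) * Num.sqrt (\sum_j y j ^+ 2)).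
Proof.
move=> e0 d0 edn.
have [a [K [a0 xa]]] := dyadic_range x.
pose lev (k : nat) i := (a * 2 ^+ k <= `|x i|) && (`|x i| < a * 2 ^+ k.+1).
pose win (k : nat) j := (e * (a * 2 ^+ k) <= `|y j|)
  && (d * `|y j| < a * 2 ^+ k.+1).
pose X k i := x i * (lev k i)%:R; pose Y k j := y j * (win k j)%:R.
have indic2 (t : bool) : (t%:R : R) ^+ 2 = t%:R.
  by case: t; rewrite ?expr1n ?expr0n.
have lev_sum i : \sum_(k < K) ((lev k i)%:R : R) <= 1.
  have := sum_window_le `|x i| 1 K a0.
  by under eq_bigr do rewrite addn1.
(* The upper end of the window, with [2 <= e * d * 2 ^+ n], forces [|y j| < e * a * 2 ^+ (k + n)]: a
   telescoping window of length [n]. *)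
have win_sum j : \sum_(k < K) ((win k j)%:R : R) <= n%:R.
  apply: le_trans (sum_window_le `|y j| n K (mulr_gt0 e0 a0)).
  apply: ler_sum => k _; rewrite ler_nat /win -!mulrA; case: (e * (a * 2 ^+ k) <= `|y j|) => //=.
  have [ltd|] := ltP (d * `|y j|); last by [].
  suff -> : `|y j| < e * (a * 2 ^+ (k + n)) by [].
  rewrite -(ltr_pM2l d0); apply: lt_le_trans ltd _.
  rewrite exprS exprD.
  have -> : d * (e * (a * (2 ^+ k * 2 ^+ n))) = e * d * 2 ^+ n * (a * 2 ^+ k).
    by ring.
  by rewrite mulrCA ler_pM2r // mulr_gt0 // exprn_gt0.
(* A far pair is paid for by the weights; a near pair occurs in exactly one level sum, that of the
   level [k0] of [x i]. *)
have far_near : \sum_i \sum_j x i * y j * b i j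
    <= \sum_i \sum_j `|b i j| * (e * x i ^+ 2 + d * y j ^+ 2)
       + \sum_(k < K) \sum_i X k i * (\sum_j b i j * Y k j).
  rewrite [X in _ + X]exchange_big /= -big_split /=; apply: ler_sum => i _.
  under [X in _ + X]eq_bigr do rewrite mulr_sumr.
  rewrite [X in _ + X]exchange_big /= -big_split /=; apply: ler_sum => j _.
  have -> : \sum_(k < K) X k i * (b i j * Y k j)
      = x i * y j * b i j * \sum_(k < K) ((lev k i)%:R * (win k j)%:R).
    by rewrite mulr_sumr; apply: eq_bigr => k _; rewrite /X /Y; ring.
  have rhs0 : 0 <= `|b i j| * (e * x i ^+ 2 + d * y j ^+ 2).
    by rewrite mulr_ge0 // addr_ge0 // mulr_ge0 ?sqr_ge0 // ltW.
  have [xi0|xi0] := eqVneq (x i) 0; first by move: rhs0; rewrite xi0 !mul0r addr0.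
  have [k0 lev0] := dyadic_level (xa i xi0).
  have levN (k : 'I_K) : k != k0 -> lev k i = false.
    move=> kk0; apply/negP => levk.
    have := lev_sum i; rewrite (bigD1 k0) //= (bigD1 k) //= levk.
    rewrite [lev k0 i]lev0 /=.
    have : 0 <= \sum_(k1 < K | (k1 != k0) && (k1 != k)) ((lev k1 i)%:R : R).
      by apply: sumr_ge0 => ? _; exact: ler0n.
    lra.
  rewrite (bigD1 k0) //= big1 ?addr0 => [|k /levN ->]; last by rewrite mul0r.
  rewrite [lev k0 i]lev0 mul1r.
  case winP : (win k0 j); first by rewrite mulr1 lerDr.
  rewrite mulr0 addr0 (le_trans (ler_norm _)) // 2!normrM mulrC ler_wpM2l //.
  rewrite -(real_normK (num_real (x i))) -(real_normK (num_real (y j))).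
  move: lev0 winP; rewrite /win => /andP[xlo xhi] /negbT.
  have x0 := normr_ge0 (x i); have y0 := normr_ge0 (y j).
  (* Below the window [|y j| <= e * |x i|], above it [|x i| <= d * |y j|]; either way the product is
     at most one of the two weighted squares. *)
  rewrite negb_and -ltNge -leNgt => /orP[ylo|yhi].
    rewrite ler_wpDr ?mulr_ge0 ?sqr_ge0 ?(ltW d0) // mulrC expr2 mulrA.
    by rewrite ler_wpM2r // (le_trans (ltW ylo)) // ler_pM2l.
  rewrite ler_wpDl ?mulr_ge0 ?sqr_ge0 ?(ltW e0) // expr2 mulrA.
  by rewrite ler_wpM2r // (le_trans (ltW xhi)).
apply: le_trans far_near (lerD (sum_weights_le _ _ (ltW e0) (ltW d0)) _).
(* On level [k], [|x i|] lies between [v] and [2 * v]: the upper end takes it out of the sum, the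
   lower end turns [v * Num.sqrt #|S|%:R] back into the norm of [X k]. *)
have block (k : 'I_K) : \sum_i X k i * (\sum_j b i j * Y k j)
    <= c * (2 * Num.sqrt 2)
       * (Num.sqrt (\sum_i X k i ^+ 2) * Num.sqrt (\sum_j Y k j ^+ 2)).
  pose S := [set i | lev k i]; pose v := a * 2 ^+ k.
  have v0 : 0 <= v by rewrite mulr_ge0 ?(ltW a0) // exprn_ge0.
  have le1 : \sum_i X k i * (\sum_j b i j * Y k j)
      <= 2 * v * \sum_(i in S) `|\sum_j b i j * Y k j|.
    rewrite mulr_sumr [X in _ <= X]big_mkcond /=; apply: ler_sum => i _.
    rewrite inE /X; case levk : (lev k i); last by rewrite mulr0 mul0r.
    rewrite mulr1 (le_trans (ler_norm _)) // normrM ler_wpM2r //.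
    move/andP: levk => [_ /ltW]; rewrite exprS /v; lra.
  apply: le_trans le1 _.
  apply: le_trans (ler_wpM2l _ (sum_norm_le S (Y k))) _; first by lra.
  have le2 : v * Num.sqrt #|S|%:R <= Num.sqrt (\sum_i X k i ^+ 2).
    rewrite -[v in X in X <= _]ger0_norm // -sqrtr_sqr -sqrtrM ?sqr_ge0 //.
    rewrite ler_wsqrtr // -sum1_card natr_sum mulr_sumr big_mkcond /=.
    apply: ler_sum => i _; rewrite inE /X.
    case levk : (lev k i); last by rewrite sqr_ge0.
    move/andP: levk => [lo _]; rewrite !mulr1 -(real_normK (num_real (x i))).
    by rewrite lerXn2r ?nnegrE.
  set s2 := Num.sqrt 2; set q := Num.sqrt (\sum_j _).
  have -> : 2 * v * (c * s2 * Num.sqrt #|S|%:R * q)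
      = c * (2 * s2) * (v * Num.sqrt #|S|%:R * q) by ring.
  rewrite ler_wpM2l //; last by rewrite ler_wpM2r // sqrtr_ge0.
  by rewrite mulr_ge0 // mulr_ge0 // sqrtr_ge0.
apply: le_trans (ler_sum _ (fun k _ => block k)) _.
rewrite -mulr_sumr -[X in _ <= X]mulrA ler_wpM2l //.
  by rewrite mulr_ge0 // mulr_ge0 // sqrtr_ge0.
(* Cauchy-Schwarz over the levels: each [x i] survives in at most one [X k], each [y j] in at most
   [n] of the [Y k]. *)
apply: le_trans (sum_mul_le_sqrt _ _) _.
rewrite [X in _ <= X]mulrCA -[X in _ <= _ * X]sqrtrM //.
apply: ler_pM; rewrite ?sqrtr_ge0 // ler_wsqrtr //.
  under eq_bigr do rewrite (sqr_sqrtr (sumr_ge0 _ (fun i _ => sqr_ge0 _))).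
  rewrite exchange_big /=; apply: ler_sum => i _.
  under eq_bigr do rewrite /X exprMn indic2.
  rewrite -mulr_sumr ler_piMr ?sqr_ge0 //.
under eq_bigr do rewrite (sqr_sqrtr (sumr_ge0 _ (fun j _ => sqr_ge0 _))).
rewrite exchange_big /= mulr_sumr; apply: ler_sum => j _.
under eq_bigr do rewrite /Y exprMn indic2.
by rewrite -mulr_sumr mulrC ler_wpM2r ?sqr_ge0.
Qed.
End BilinearBound.

(** * Hermitian matrices and singular values *)

Local Notation Re := complex.Re.
Local Notation Im := complex.Im.
Local Notation normc := ComplexField.Normc.normc.
Local Notation "x %:C" := (real_complex _ x) (format "x %:C") : ring_scope.

Section ComplexModulus.
Variable R : rcfType.
Implicit Types z w : R[i].

Lemma ReD z w : Re (z + w) = Re z + Re w.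
Proof. by case: z w => [? ?] [? ?]. Qed.

Lemma ReMl (a : R) z : Re (a%:C * z) = a * Re z.
Proof. by case: z => ? ? /=; rewrite mul0r subr0. Qed.

Lemma Re_sum (I : finType) (P : pred I) (F : I -> R[i]) :
  Re (\sum_(i | P i) F i) = \sum_(i | P i) Re (F i).
Proof. by apply: (big_morph (@complex.Re R) ReD). Qed.

Lemma normc_ge0 z : 0 <= normc z.
Proof. by case: z => a b; exact: sqrtr_ge0. Qed.

Lemma normc_sqr z : normc z ^+ 2 = Re z ^+ 2 + Im z ^+ 2.
Proof. by case: z => a b /=; rewrite sqr_sqrtr // addr_ge0 ?sqr_ge0. Qed.

Lemma mul_conj_normc z : Num.conj z * z = (normc z ^+ 2)%:C.
Proof.
rewrite normc_sqr; case: z => a b; apply/eqP; rewrite eq_complex /=.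
by apply/andP; split; apply/eqP; ring.
Qed.

Lemma norm_Re_le z : `|Re z| <= normc z.
Proof. by case: z => a b /=; rewrite -sqrtr_sqr ler_wsqrtr // lerDl sqr_ge0. Qed.

Lemma normc_sum_le (I : finType) (F : I -> R[i]) :
  normc (\sum_i F i) <= \sum_i normc (F i).
Proof.
elim/big_rec2: _ => [|i y z _ le_zy]; first by rewrite ComplexField.Normc.normc0.
by apply: le_trans (le_normcD _ _) _; rewrite lerD2l.
Qed.

Lemma normc_real (a : R) : normc a%:C = `|a|.
Proof. by rewrite /= expr0n addr0 sqrtr_sqr. Qed.
End ComplexModulus.

Section Adjoint.
Variables (R : realType) (N : nat).
Local Notation M := 'M[R[i]]_N.
Implicit Types A B U V W X Y Z : M.

Lemma adjmxE A i j : adjmx A i j = Num.conj (A j i).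
Proof. by rewrite !mxE. Qed.

Lemma adjmxK A : adjmx (adjmx A) = A.
Proof. exact: trmxCK. Qed.

Lemma adjmxM A B : adjmx (A *m B) = adjmx B *m adjmx A.
Proof. by rewrite /adjmx trmx_mul map_mxM. Qed.

Lemma adjmxD A B : adjmx (A + B) = adjmx A + adjmx B.
Proof. by rewrite /adjmx raddfD /= map_mxD. Qed.

Lemma adjmxZ (a : R[i]) A : adjmx (a *: A) = Num.conj a *: adjmx A.
Proof. by rewrite /adjmx linearZ /= map_mxZ. Qed.

Definition unitary U := U *m adjmx U = 1%:M.

Lemma unitary_adjl U : unitary U -> adjmx U *m U = 1%:M.
Proof. by move/mulmx1C. Qed.

Lemma unitary_adj U : unitary U -> unitary (adjmx U).
Proof. by move=> uU; rewrite /unitary adjmxK unitary_adjl. Qed.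

Lemma unitaryM U V : unitary U -> unitary V -> unitary (U *m V).
Proof.
by move=> uU uV; rewrite /unitary adjmxM mulmxA -(mulmxA U) uV mulmx1.
Qed.

Lemma gram_diag Z k : (adjmx Z *m Z) k k = (\sum_i normc (Z i k) ^+ 2)%:C.
Proof.
rewrite mxE rmorph_sum; apply: eq_bigr => i _.
by rewrite adjmxE mul_conj_normc.
Qed.

Lemma unitary_col U k : unitary U -> \sum_i normc (U i k) ^+ 2 = 1.
Proof.
move=> /unitary_adjl uU; have := gram_diag U k.
by rewrite uU mxE eqxx => /(congr1 (@complex.Re R)) /=.
Qed.

Lemma unitary_row U k : unitary U -> \sum_i normc (U k i) ^+ 2 = 1.
Proof.
move=> /unitary_adj /(@unitary_col _ k) <-; apply: eq_bigr => i _.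
by rewrite adjmxE normc_sqr [RHS]normc_sqr; case: (U k i) => a b /=; rewrite sqrrN.
Qed.

(* The real inner product whose norm is [schatten2]. *)
Definition rip Z Y : R := Re (\tr (adjmx Y *m Z)).

Lemma ripE Z Y :
  rip Z Y = \sum_(p : 'I_N * 'I_N) (Re (Z p.1 p.2) * Re (Y p.1 p.2)
                                    + Im (Z p.1 p.2) * Im (Y p.1 p.2)).
Proof.
rewrite /rip /mxtrace Re_sum -(pair_bigA _ (fun i j => Re (Z i j) * Re (Y i j)
                                    + Im (Z i j) * Im (Y i j))) /= exchange_big /=.
apply: eq_bigr => i _; rewrite mxE Re_sum; apply: eq_bigr => j _.
rewrite adjmxE; case: (Z j i) (Y j i) => a b [c d] /=; ring.
Qed.

Lemma ripDl X Z Y : rip (X + Z) Y = rip X Y + rip Z Y.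
Proof. by rewrite /rip mulmxDr mxtraceD ReD. Qed.

Lemma ripZl (a : R) Z Y : rip (a%:C *: Z) Y = a * rip Z Y.
Proof. by rewrite /rip -scalemxAr mxtraceZ ReMl. Qed.

Lemma rip_suml (I : finType) (P : pred I) (F : I -> M) Y :
  rip (\sum_(i | P i) F i) Y = \sum_(i | P i) rip (F i) Y.
Proof.
apply: (big_morph (fun Z => rip Z Y)) => [A B|]; first exact: ripDl.
by rewrite /rip mulmx0 mxtrace0.
Qed.

Lemma ripC Z Y : rip Z Y = rip Y Z.
Proof. by rewrite !ripE; apply: eq_bigr => p _; ring. Qed.

Lemma rip_ge0 Z : 0 <= rip Z Z.
Proof.
by rewrite ripE; apply: sumr_ge0 => p _; rewrite -!expr2 addr_ge0 ?sqr_ge0.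
Qed.

Lemma rip_normc Z : rip Z Z = \sum_k \sum_i normc (Z i k) ^+ 2.
Proof.
by rewrite /rip /mxtrace Re_sum; apply: eq_bigr => k _; rewrite gram_diag.
Qed.

Lemma ripMr U Z Y : unitary U -> rip (Z *m U) (Y *m U) = rip Z Y.
Proof.
move=> uU; rewrite /rip adjmxM -mulmxA mxtrace_mulC -mulmxA -mulmxA uU.
by rewrite mulmx1.
Qed.

Lemma rip_le Z Y : rip Z Y <= Num.sqrt (rip Z Z) * Num.sqrt (rip Y Y).
Proof.
pose re_im A (q : bool * ('I_N * 'I_N)) :=
  if q.1 then Re (A q.2.1 q.2.2) else Im (A q.2.1 q.2.2).
have ripI A B : rip A B = \sum_q re_im A q * re_im B q.
  rewrite ripE -(pair_bigA _ (fun t p => re_im A (t, p) * re_im B (t, p))) /=.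
  by rewrite big_bool /= -big_split.
rewrite !ripI; under [X in Num.sqrt X * _]eq_bigr do rewrite -expr2.
under [X in _ <= _ * Num.sqrt X]eq_bigr do rewrite -expr2.
exact: sum_mul_le_sqrt.
Qed.

Lemma hermitian_spectral A : adjmx A = A ->
  let V := spectralmx A in
  unitary V /\ A = adjmx V *m diag_mx (spectral_diag A) *m V.
Proof.
move=> hA V; have uV : V \is unitarymx := spectral_unitarymx A.
split; first exact/unitarymxP.
have nA : A \is normalmx by apply/normalmxP; rewrite -/(adjmx A) hA.
by rewrite {1}(orthomx_spectralP nA) invmx_unitary.
Qed.

Lemma gram_hermitian Z : adjmx (adjmx Z *m Z) = adjmx Z *m Z.
Proof. by rewrite adjmxM adjmxK. Qed.

(* The rows of [rsv Z] are right singular vectors of [Z]: the columns of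
   [Z *m adjmx (rsv Z)] are orthogonal, of lengths the [singval Z k]. *)
Definition rsv Z : M := spectralmx (adjmx Z *m Z).

Lemma unitary_rsv Z : unitary (rsv Z).
Proof. by case: (hermitian_spectral (gram_hermitian Z)). Qed.

(** A unitary on the left does not change the Gram matrix; allowing [W] here lets
    [W *m Z *m adjmx W] be factored through the singular vectors of [Z]. *)
Lemma gram_rsv W Z : unitary W ->
  let Q := W *m Z *m adjmx (rsv Z) in
  adjmx Q *m Q = diag_mx (spectral_diag (adjmx Z *m Z)).
Proof.
move=> /unitary_adjl uW Q; have [uV ZE] := hermitian_spectral (gram_hermitian Z).
rewrite /Q !adjmxM adjmxK.
rewrite !mulmxA -(mulmxA _ (adjmx W) W) uW mulmx1 -(mulmxA (rsv Z)).
rewrite [X in _ *m X *m _]ZE -/(rsv Z) !mulmxA uV mul1mx -mulmxA uV.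
by rewrite mulmx1.
Qed.

Lemma singval_ge0 Z k : 0 <= singval Z k.
Proof. exact: sqrtr_ge0. Qed.

Lemma singval_col W Z k : unitary W ->
  singval Z k ^+ 2 = \sum_i normc ((W *m Z *m adjmx (rsv Z)) i k) ^+ 2.
Proof.
move=> uW; have := gram_diag (W *m Z *m adjmx (rsv Z)) k.
rewrite (gram_rsv _ uW) mxE eqxx mulr1n /singval => -> /=.
by rewrite sqr_sqrtr // sumr_ge0 // => i _; rewrite sqr_ge0.
Qed.

Lemma unitary1 : unitary 1%:M.
Proof. by rewrite /unitary mul1mx /adjmx trmx1 map_mx1. Qed.

Lemma schatten2E Z : schatten2 Z = Num.sqrt (rip Z Z).
Proof.
rewrite /schatten2; congr Num.sqrt.
rewrite -(ripMr _ _ (unitary_adj (unitary_rsv Z))) rip_normc.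
apply: eq_bigr => k _; rewrite (singval_col _ _ unitary1).
by apply: eq_bigr => i _; rewrite mul1mx.
Qed.

(** Write [W *m Z *m adjmx W] as [Q *m G] with [G] unitary and the columns of [Q] of lengths
    [singval Z k]. For each [k], Cauchy-Schwarz in [j] against a unit row of [G] leaves
    [singval Z k]. *)
Lemma sum_norm_diag_le W Z : unitary W ->
  \sum_j `|Re ((W *m Z *m adjmx W) j j)| <= schatten1 Z.
Proof.
move=> uW; pose Q := W *m Z *m adjmx (rsv Z); pose G := rsv Z *m adjmx W.
have uV := unitary_rsv Z.
have QG : W *m Z *m adjmx W = Q *m G.
  by rewrite /Q /G mulmxA -(mulmxA (W *m Z)) (unitary_adjl uV) mulmx1.
apply: le_trans (_ : \sum_j \sum_k normc (Q j k) * normc (G k j) <= _).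
  apply: ler_sum => j _; rewrite QG (le_trans (norm_Re_le _)) // mxE.
  apply: le_trans (normc_sum_le _) _; apply: ler_sum => k _.
  by rewrite ComplexField.Normc.normcM.
rewrite exchange_big /=; apply: ler_sum => k _.
apply: le_trans (sum_mul_le_sqrt _ _) _.
rewrite -(singval_col _ _ uW) sqrtr_sqr ger0_norm ?singval_ge0 //.
rewrite unitary_row ?sqrtr1 ?mulr1 //; exact: unitaryM (unitary_adj uW).
Qed.

Lemma singval_le_Inf Z k : singval Z k <= schattenInf Z.
Proof. exact: le_bigmax. Qed.

(** With the same factorization, the squared length of column [j] of [Q *m G] is an average of the
    [singval Z k ^+ 2], weighted by the unit column [j] of [G]; the diagonal entry is one coordinate
    of that column. *)
Lemma norm_diag_le W Z j : unitary W ->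
  `|Re ((W *m Z *m adjmx W) j j)| <= schattenInf Z.
Proof.
move=> uW; pose Q := W *m Z *m adjmx (rsv Z); pose G := rsv Z *m adjmx W.
have uV := unitary_rsv Z.
have uG : unitary G := unitaryM uV (unitary_adj uW).
have QG : W *m Z *m adjmx W = Q *m G.
  by rewrite /Q /G mulmxA -(mulmxA (W *m Z)) (unitary_adjl uV) mulmx1.
have I0 : 0 <= schattenInf Z by exact: bigmax_ge_id.
have col : \sum_i normc ((Q *m G) i j) ^+ 2 <= schattenInf Z ^+ 2.
  have := gram_diag (Q *m G) j.
  rewrite adjmxM mulmxA -(mulmxA (adjmx G)) (gram_rsv _ uW) => /(congr1 (@complex.Re R)) /= <-.
  rewrite mxE Re_sum -[X in _ <= X]mulr1 -(unitary_col j uG) mulr_sumr.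
  apply: ler_sum => k _; rewrite mul_mx_diag mxE adjmxE mulrAC mul_conj_normc ReMl.
  rewrite mulrC ler_wpM2r ?sqr_ge0 //.
  have <- : singval Z k ^+ 2 = Re (spectral_diag (adjmx Z *m Z) 0 k).
    rewrite (singval_col _ _ uW).
    have := gram_diag Q k.
    by rewrite (gram_rsv _ uW) mxE eqxx mulr1n => -> /=.
  by rewrite lerXn2r ?nnegrE ?singval_ge0 ?singval_le_Inf.
rewrite QG (le_trans (norm_Re_le _)) // -(@ler_pXn2r _ 2) ?nnegrE ?normc_ge0 //.
apply: le_trans col; rewrite (bigD1 j) //= lerDl sumr_ge0 // => i _.
exact: sqr_ge0.
Qed.

(** Spectral form in a fixed eigenbasis: for unitary [U], indicator vectors give orthogonal
    projections and sign vectors give contractions. *)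
Definition dg U (x : 'I_N -> R) : M :=
  adjmx U *m diag_mx (\row_j (x j)%:C) *m U.

Lemma adjmx_real_diag (x : 'I_N -> R) :
  adjmx (diag_mx (\row_j (x j)%:C)) = diag_mx (\row_j (x j)%:C).
Proof.
apply/matrixP => i j; rewrite adjmxE !mxE eq_sym.
have [->|_] := eqVneq i j; rewrite ?mulr1n ?mulr0n ?conjC0 //.
exact: conjc_real.
Qed.

Lemma adjmx_dg U x : adjmx (dg U x) = dg U x.
Proof. by rewrite /dg !adjmxM adjmxK adjmx_real_diag mulmxA. Qed.

Lemma hermitian_dg A : adjmx A = A ->
  exists U (x : 'I_N -> R), unitary U /\ A = dg U x.
Proof.
move=> hA; have [uV AE] := hermitian_spectral hA.
exists (spectralmx A), (fun j => Re (spectral_diag A 0 j)); split=> //.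
rewrite {1}AE /dg; do 2!congr (_ *m _); congr diag_mx; apply/rowP => j.
rewrite mxE RRe_real //.
have /hermitian_spectral_diag_real/mxOverP/(_ 0 j) : A \is hermsymmx.
  by apply/is_hermitianmxP; rewrite expr0 scale1r.
by [].
Qed.

Lemma dgM U x y : unitary U -> dg U x *m dg U y = dg U (fun i => x i * y i).
Proof.
move=> uU; rewrite /dg !mulmxA -(mulmxA _ U) uU mulmx1 -(mulmxA (adjmx U)).
rewrite mulmx_diag; do 2!congr (_ *m _); congr diag_mx.
by apply/rowP => j; rewrite !mxE rmorphM.
Qed.

Lemma rip_dg W Z y : unitary W ->
  rip Z (dg W y) = \sum_j y j * Re ((W *m Z *m adjmx W) j j).
Proof.
move=> uW; rewrite /rip adjmx_dg /dg -!mulmxA mxtrace_mulC -!mulmxA.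
rewrite /mxtrace Re_sum; apply: eq_bigr => j _.
by rewrite mul_diag_mx mxE mxE ReMl mulmxA.
Qed.

Lemma schatten2_dg U x : unitary U ->
  schatten2 (dg U x) = Num.sqrt (\sum_i x i ^+ 2).
Proof.
move=> uU; rewrite schatten2E rip_dg //; congr Num.sqrt.
apply: eq_bigr => j _; rewrite /dg !mulmxA uU mul1mx -mulmxA uU mulmx1.
by rewrite !mxE eqxx mulr1n expr2.
Qed.

Lemma schattenInf_dg U x : unitary U -> (forall i, `|x i| <= 1) ->
  schattenInf (dg U x) <= 1.
Proof.
move=> uU x1; apply: bigmax_le => // k _.
rewrite -(@ler_pXn2r _ 2) ?nnegrE ?singval_ge0 // expr1n (singval_col _ _ uU).
set V := rsv _; pose G := U *m adjmx V.
have uG : unitary G by exact: unitaryM (unitary_adj (unitary_rsv _)).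
rewrite -(unitary_col k uG); apply: ler_sum => i _.
have -> : U *m dg U x *m adjmx V = diag_mx (\row_j (x j)%:C) *m G.
  by rewrite /dg /G !mulmxA uU mul1mx.
rewrite mul_diag_mx !mxE ComplexField.Normc.normcM exprMn normc_real.
by rewrite ler_piMl ?sqr_ge0 // exprn_ile1.
Qed.

(** Here [adjmx P *m P] is [P] itself, so its eigenvalues are idempotent, hence 0 or 1 and fixed by
    the square root; they sum to the trace. *)
Lemma schatten1_proj (P : M) : P *m P = P -> adjmx P = P -> schatten1 P = Re (\tr P).
Proof.
move=> PP aP; have := gram_rsv P unitary1; have uV := unitary_rsv P.
rewrite /schatten1 /singval; set d := spectral_diag _.
rewrite mul1mx adjmxM adjmxK mulmxA -(mulmxA (rsv P)) aP PP => dE.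
have -> : \tr P = \sum_i d 0 i.
  by rewrite -mxtrace_diag -dE mxtrace_mulC mulmxA (unitary_adjl uV) mul1mx.
rewrite Re_sum; apply: eq_bigr => i _.
have : diag_mx d *m diag_mx d = diag_mx d.
  rewrite -dE !mulmxA -(mulmxA _ (adjmx (rsv P)) (rsv P)) (unitary_adjl uV).
  by rewrite mulmx1 -(mulmxA _ P P) PP.
move=> /matrixP/(_ i i); rewrite mul_diag_mx !mxE eqxx mulr1n => /eqP.
rewrite -subr_eq0 -[X in _ - X]mulr1 -mulrBr mulf_eq0 subr_eq0.
by case/orP => /eqP -> /=; rewrite ?sqrtr0 ?sqrtr1.
Qed.
End Adjoint.

(** * Norm properties and comparison of the three Schatten norms *)

Section SchattenTwo.
Variables (R : realType) (N : nat).
Local Notation M := 'M[R[i]]_N.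
Implicit Types X Y Z : M.

Lemma schatten2_ge0 Z : 0 <= schatten2 Z.
Proof. exact: sqrtr_ge0. Qed.

Lemma schatten2_sqr Z : schatten2 Z ^+ 2 = rip Z Z.
Proof. by rewrite schatten2E sqr_sqrtr // rip_ge0. Qed.

Lemma rip_le_schatten2 Z Y : rip Z Y <= schatten2 Z * schatten2 Y.
Proof. by rewrite !schatten2E rip_le. Qed.

Lemma schatten2D Z Y : schatten2 (Z + Y) <= schatten2 Z + schatten2 Y.
Proof.
have := schatten2_ge0 (Z + Y); rewrite le_eqVlt => /orP[/eqP <-|s0].
  by rewrite addr_ge0 // schatten2_ge0.
rewrite -(ler_pM2r s0) -expr2 schatten2_sqr ripDl mulrDl.
by rewrite lerD // rip_le_schatten2.
Qed.

Lemma schatten2Z (a : R[i]) Z : schatten2 (a *: Z) = normc a * schatten2 Z.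
Proof.
rewrite !schatten2E !rip_normc -[normc a]ger0_norm ?normc_ge0 // -sqrtr_sqr.
rewrite -sqrtrM ?sqr_ge0 //; congr Num.sqrt; rewrite mulr_sumr.
apply: eq_bigr => k _; rewrite mulr_sumr; apply: eq_bigr => i _.
by rewrite mxE ComplexField.Normc.normcM exprMn.
Qed.

Lemma schatten2_0 : schatten2 (0 : M) = 0.
Proof.
by rewrite -(scale0r (0 : M)) schatten2Z ComplexField.Normc.normc0 mul0r.
Qed.

Lemma normc_le_schatten2 Z i j : normc (Z i j) <= schatten2 Z.
Proof.
rewrite -(@ler_pXn2r _ 2) ?nnegrE ?normc_ge0 ?schatten2_ge0 //.
rewrite schatten2_sqr rip_normc (bigD1 j) //= (bigD1 i) //= -addrA lerDl.
rewrite addr_ge0 // sumr_ge0 // => ? _; rewrite ?sqr_ge0 //.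
by apply: sumr_ge0 => ? _; rewrite sqr_ge0.
Qed.

Lemma schatten2_gt0 Z : Z != 0 -> 0 < schatten2 Z.
Proof.
apply: contraNT; rewrite -leNgt => Z0; apply/eqP/matrixP => i j; rewrite mxE.
apply: ComplexField.Normc.eq0_normc; apply/eqP; rewrite eq_le normc_ge0 andbT.
exact: le_trans (normc_le_schatten2 Z i j) Z0.
Qed.

Lemma singval_le_schatten2 Z k : singval Z k <= schatten2 Z.
Proof.
rewrite -[singval Z k]ger0_norm ?singval_ge0 // -sqrtr_sqr ler_wsqrtr //.
by rewrite (bigD1 k) //= lerDl sumr_ge0 // => ? _; rewrite sqr_ge0.
Qed.

(** This and the next comparisons, with crude constants depending on [N], serve to show that the
    operator norms are finite. *)
Lemma schatten1_le_schatten2 Z : schatten1 Z <= N%:R * schatten2 Z.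
Proof.
rewrite -[N in N%:R]card_ord -sum1_card natr_sum mulr_suml.
by apply: ler_sum => k _; rewrite mul1r singval_le_schatten2.
Qed.

Lemma schattenInf_le_schatten2 Z : schattenInf Z <= schatten2 Z.
Proof.
by apply: bigmax_le => [|k _]; [exact: schatten2_ge0|exact: singval_le_schatten2].
Qed.

Lemma schatten1_ge0 Z : 0 <= schatten1 Z.
Proof. by apply: sumr_ge0 => k _; exact: singval_ge0. Qed.

Lemma schattenInf_ge0 Z : 0 <= schattenInf Z.
Proof. exact: bigmax_ge_id. Qed.

Lemma schatten2_le_schatten1 Z : schatten2 Z <= schatten1 Z.
Proof.
rewrite -[schatten1 Z]ger0_norm ?schatten1_ge0 // -sqrtr_sqr ler_wsqrtr //.
rewrite expr2 {1}/schatten1 mulr_suml; apply: ler_sum => k _.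
rewrite expr2 ler_wpM2l ?singval_ge0 // /schatten1 (bigD1 k) //= lerDl.
by apply: sumr_ge0 => ? _; exact: singval_ge0.
Qed.

Lemma schatten2_le_schattenInf Z : schatten2 Z <= N%:R * schattenInf Z.
Proof.
apply: le_trans (schatten2_le_schatten1 Z) _.
rewrite -[N in N%:R]card_ord -sum1_card natr_sum mulr_suml.
by apply: ler_sum => k _; rewrite mul1r singval_le_Inf.
Qed.

(** Polarization calls the hermitian bounds on [w *: T] with [w] equal to 1, ['i%C] or [- 'i%C]. *)
Lemma singval_phase (w : R[i]) Z k : Num.conj w * w = 1 ->
  singval (w *: Z) k = singval Z k.
Proof.
by move=> w1; rewrite /singval adjmxZ -scalemxAl -scalemxAr scalerA w1 scale1r.
Qed.

Lemma schatten1_phase (w : R[i]) Z : Num.conj w * w = 1 ->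
  schatten1 (w *: Z) = schatten1 Z.
Proof. by move=> w1; apply: eq_bigr => k _; rewrite singval_phase. Qed.

Lemma schatten2_phase (w : R[i]) Z : Num.conj w * w = 1 ->
  schatten2 (w *: Z) = schatten2 Z.
Proof.
by move=> w1; congr Num.sqrt; apply: eq_bigr => k _; rewrite singval_phase.
Qed.

Lemma schattenInf_phase (w : R[i]) Z : Num.conj w * w = 1 ->
  schattenInf (w *: Z) = schattenInf Z.
Proof. by move=> w1; apply: eq_bigr => k _; rewrite singval_phase. Qed.
End SchattenTwo.

(** * Operator norms as finite, attained-from-above suprema *)

Section OperatorNorm.
Variables (R : realType) (N : nat).
Local Notation M := 'M[R[i]]_N.
Variable T : {linear M -> M}.

Lemma schatten2_bounded :
  exists2 B : R, 0 <= B & forall X, schatten2 (T X) <= B * schatten2 X.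
Proof.
exists (\sum_i \sum_j schatten2 (T (delta_mx i j))).
  by do 2![apply: sumr_ge0 => ? _]; exact: schatten2_ge0.
move=> X; rewrite {1}[X]matrix_sum_delta linear_sum mulr_suml.
have sum_le (I : finType) (F : I -> M) :
    schatten2 (\sum_i F i) <= \sum_i schatten2 (F i).
  elim/big_rec2: _ => [|i y Z _ le_Zy]; first by rewrite schatten2_0.
  by apply: le_trans (schatten2D _ _) _; rewrite lerD2l.
apply: le_trans (sum_le _ _) _; apply: ler_sum => i _.
rewrite linear_sum mulr_suml; apply: le_trans (sum_le _ _) _.
apply: ler_sum => j _; rewrite linearZ /= schatten2Z mulrC.
by rewrite ler_wpM2l ?schatten2_ge0 ?normc_le_schatten2.
Qed.

Variables (nrm : M -> R) (C : R).
Hypothesis C0 : 0 <= C.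
Hypothesis nrm_ge0 : forall X, 0 <= nrm X.
Hypothesis nrm_le : forall X, nrm X <= C * schatten2 X.
Hypothesis le_nrm : forall X, schatten2 X <= C * nrm X.

Let nrm_gt0 (X : M) : X != 0 -> 0 < nrm X.
Proof.
move=> /schatten2_gt0 /lt_le_trans /(_ (le_nrm X)).
by move: C0; rewrite le_eqVlt => /orP[/eqP <-|/pmulr_rgt0 ->]; rewrite ?mul0r ?ltxx.
Qed.

(** Boundedness of the ratios, without which [sup] need not dominate them; it is transferred from
    [schatten2] by equivalence of norms. *)
Let ratio_le : exists B : R, forall X : M, X != 0 -> nrm (T X) / nrm X <= B.
Proof.
have [B B0 TB] := schatten2_bounded; exists (C * (B * C)) => X X0.
rewrite ler_pdivrMr ?nrm_gt0 // (le_trans (nrm_le _)) // -!mulrA ler_wpM2l //.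
by rewrite (le_trans (TB X)) // ler_wpM2l.
Qed.

Lemma opnorm_bound (X : M) : nrm (T X) <= opnorm nrm T * nrm X.
Proof.
have [->|X0] := eqVneq X 0.
  have /eqP : nrm 0 = 0.
    apply/eqP; rewrite eq_le nrm_ge0 andbT.
    by have := nrm_le 0; rewrite schatten2_0 mulr0.
  by rewrite linear0 => /eqP ->; rewrite mulr0.
rewrite -ler_pdivrMr ?nrm_gt0 //; apply: ub_le_sup; last by exists X.
have [B TB] := ratio_le; exists B => _ [Y [Y0 ->]]; exact: TB.
Qed.

Lemma opnorm_gt0 (X : M) : T X != 0 -> 0 < opnorm nrm T.
Proof.
move=> TX0; rewrite ltNge; apply/negP => le0.
have := lt_le_trans (nrm_gt0 TX0) (opnorm_bound X).
by rewrite ltNge mulr_le0_ge0.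
Qed.

(** The non-zero [X] makes the set of ratios non-empty, so that its [sup] is a least upper bound. *)
Lemma opnorm_le (B : R) (X : M) : X != 0 ->
  (forall Y, nrm (T Y) <= B * nrm Y) -> opnorm nrm T <= B.
Proof.
move=> X0 TB; apply: ge_sup; first by exists (nrm (T X) / nrm X), X.
by move=> _ [Y [Y0 ->]]; rewrite ler_pdivrMr ?nrm_gt0.
Qed.
End OperatorNorm.

(** * Bounds on hermitian pairs and polarization *)

Section HermitianPairing.
Variables (R : realType) (N : nat).
Local Notation M := 'M[R[i]]_N.
Variables (T : {linear M -> M}) (w : R[i]) (al be c : R).
Hypothesis w1 : Num.conj w * w = 1.
Hypotheses (be0 : 0 <= be) (c0 : 0 <= c).
Hypothesis T1 : forall X, schatten1 (T X) <= al * schatten1 X.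
Hypothesis TInf : forall X, schattenInf (T X) <= be * schattenInf X.

Let e (U : M) (i : 'I_N) : M := dg U (fun k => (k == i)%:R).
(** By [rip_e], this is the real inner product of [w *: T (e U i)] with the rank-one projection
    [e W j]. *)
Let b (U W : M) (i j : 'I_N) : R :=
  Re ((W *m (w *: T (e U i)) *m adjmx W) j j).

Let rip_e (W Z : M) j : unitary W ->
  rip Z (e W j) = Re ((W *m Z *m adjmx W) j j).
Proof.
move=> uW; rewrite rip_dg // (bigD1 j) //= eqxx mul1r big1 ?addr0 // => k /negbTE.
by move=> ->; rewrite mul0r.
Qed.

Let T_dg (U : M) (x : 'I_N -> R) :
  w *: T (dg U x) = \sum_i (x i)%:C *: (w *: T (e U i)).
Proof.
have -> : dg U x = \sum_i (x i)%:C *: e U i.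
  rewrite /e /dg; under eq_bigr do rewrite scalemxAl scalemxAr.
  rewrite -mulmx_suml -mulmx_sumr; congr (_ *m _ *m _).
  apply/matrixP => i j; rewrite summxE !mxE.
  have [<-|ij] := eqVneq i j; last first.
    by rewrite big1 // => k _; rewrite !mxE (negbTE ij) mulr0n mulr0.
  rewrite (bigD1 i) //= !mxE !eqxx !mulr1n mulr1 big1 ?addr0 // => k /negbTE ki.
  by rewrite !mxE eqxx mulr1n eq_sym ki mulr0.
rewrite linear_sum scaler_sumr; apply: eq_bigr => i _.
by rewrite linearZ /= !scalerA mulrC.
Qed.

Let rip_T (U W : M) x y : unitary W ->
  rip (w *: T (dg U x)) (dg W y) = \sum_i \sum_j x i * y j * b U W i j.
Proof.
move=> uW; rewrite T_dg rip_suml; apply: eq_bigr => i _.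
rewrite ripZl rip_dg // mulr_sumr; apply: eq_bigr => j _.
by rewrite mulrA.
Qed.

(** A row lists the real parts of the diagonal of the image of a projection of trace norm 1, in the
    basis given by [W]. *)
Let row_sum (U W : M) i : unitary U -> unitary W ->
  \sum_j `|b U W i j| <= al.
Proof.
move=> uU uW; apply: le_trans (sum_norm_diag_le _ uW) _.
rewrite schatten1_phase //; apply: le_trans (T1 _) _.
have eM : e U i *m e U i = e U i.
  rewrite /e dgM //; congr dg; apply/funext => k.
  by rewrite -natrM mulnb andbb.
suff -> : schatten1 (e U i) = 1 by rewrite mulr1.
(* The trace of a projection is its squared [schatten2] norm, here a sum with the single non-zero
   term 1. *)
rewrite (schatten1_proj eM (adjmx_dg _ _)) -[in LHS]eM.
rewrite -{1}[e U i]adjmx_dg -/(rip _ _) -schatten2_sqr schatten2_dg //.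
rewrite (bigD1 i) //= eqxx big1 => [|k /negbTE ->]; last by rewrite expr0n.
by rewrite expr1n addr0 sqrtr1 expr1n.
Qed.

(** Duality: with the signs of column [j] as eigenvalues, [dg U s] is a contraction, and the column
    sum is one diagonal entry of its image. *)
Let col_sum (U W : M) j : unitary U -> unitary W ->
  \sum_i `|b U W i j| <= be.
Proof.
move=> uU uW; pose s i := Num.sg (b U W i j).
have -> : \sum_i `|b U W i j| = Re ((W *m (w *: T (dg U s)) *m adjmx W) j j).
  rewrite -rip_e // T_dg rip_suml; apply: eq_bigr => i _.
  by rewrite ripZl rip_e // normrEsg.
apply: le_trans (ler_norm _) _; apply: le_trans (norm_diag_le _ _ uW) _.
rewrite schattenInf_phase //; apply: le_trans (TInf _) _.
rewrite -[X in _ <= X]mulr1 ler_wpM2l // schattenInf_dg // => i.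
by rewrite normr_sg lern1 leq_b1.
Qed.

Lemma hermitian_schur (t : R) (X Y : M) : 0 < t ->
  adjmx X = X -> adjmx Y = Y ->
  rip (w *: T X) Y <= t / 2 * al * schatten2 X ^+ 2
                      + t^-1 / 2 * be * schatten2 Y ^+ 2.
Proof.
move=> t0 /hermitian_dg[U [x [uU ->]]] /hermitian_dg[W [y [uW ->]]].
rewrite rip_T // !schatten2_dg // !sqr_sqrtr ?sumr_ge0 // => [|? _|? _]; last 2 first.
- exact: sqr_ge0.
- exact: sqr_ge0.
by apply: schur_test => // i; [exact: row_sum|exact: col_sum].
Qed.

Hypothesis TP : forall P : M, P *m P = P -> adjmx P = P ->
  schatten2 (T P) <= c * schatten2 P.

(** The indicator of [S] makes [dg U x] a projection of [schatten2] norm [Num.sqrt #|S|%:R], to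
    which [TP] applies. *)
Let restricted (U W : M) (S : {set 'I_N}) y : unitary U -> unitary W ->
  \sum_(i in S) \sum_j b U W i j * y j
    <= c * Num.sqrt #|S|%:R * Num.sqrt (\sum_j y j ^+ 2).
Proof.
move=> uU uW; pose x (i : 'I_N) : R := (i \in S)%:R.
have x2 i : x i * x i = x i by rewrite /x -natrM mulnb andbb.
have -> : \sum_(i in S) \sum_j b U W i j * y j = rip (w *: T (dg U x)) (dg W y).
  rewrite rip_T // [LHS]big_mkcond; apply: eq_bigr => i _; rewrite /x.
  case: (i \in S) => /=; last by rewrite big1 // => j _; rewrite !mul0r.
  by apply: eq_bigr => j _; rewrite mul1r mulrC.
apply: le_trans (rip_le_schatten2 _ _) _.
rewrite schatten2_phase // schatten2_dg // ler_wpM2r ?sqrtr_ge0 //.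
apply: le_trans (TP _ (adjmx_dg _ _)) _.
  by rewrite dgM //; congr dg; apply/funext.
rewrite schatten2_dg //; under eq_bigr do rewrite expr2 x2.
rewrite -sum1_card natr_sum [X in _ <= _ * Num.sqrt X]big_mkcond /=.
suff -> : \sum_i x i = \sum_i (if i \in S then 1 else 0) by [].
by apply: eq_bigr => i _; rewrite /x; case: (i \in S).
Qed.

Lemma hermitian_bound (p q : R) (n : nat) (X Y : M) :
  0 < p -> 0 < q -> 2 <= p * q * 2 ^+ n ->
  adjmx X = X -> adjmx Y = Y ->
  rip (w *: T X) Y <= p * al * schatten2 X ^+ 2 + q * be * schatten2 Y ^+ 2
     + c * (2 * Num.sqrt 2) * Num.sqrt n%:R * (schatten2 X * schatten2 Y).
Proof.
move=> p0 q0 pqn /hermitian_dg[U [x [uU ->]]] /hermitian_dg[W [y [uW ->]]].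
rewrite rip_T // !schatten2_dg // !sqr_sqrtr ?sumr_ge0 // => [|? _|? _]; last 2 first.
- exact: sqr_ge0.
- exact: sqr_ge0.
apply: bilinear_bound => //; [move=> i; exact: row_sum|move=> j; exact: col_sum|].
by move=> S z; exact: restricted.
Qed.
End HermitianPairing.

Section Polarization.
Variables (R : realType) (N : nat).
Local Notation M := 'M[R[i]]_N.

Lemma rip_adj (Z Y : M) : rip (adjmx Z) (adjmx Y) = rip Z Y.
Proof. by rewrite /rip adjmxK mxtrace_mulC -/(rip Y Z) ripC. Qed.

Lemma conj_i : Num.conj ('i%C : R[i]) = - 'i%C.
Proof. by apply/eqP; rewrite eq_complex /= oppr0 !eqxx. Qed.

Lemma conj_i_mul : Num.conj ('i%C : R[i]) * 'i%C = 1.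
Proof. by rewrite conj_i mulNr -expr2 sqr_i opprK. Qed.

Lemma rip_i (Z Y : M) : rip Z ('i%C *: Y) = rip (- 'i%C *: Z) Y.
Proof. by rewrite /rip adjmxZ conj_i -scalemxAl -scalemxAr. Qed.

Lemma ripNl (Z Y : M) : rip (- Z) Y = - rip Z Y.
Proof. by rewrite /rip mulmxN raddfN /=; case: (\tr _). Qed.

(** The two parts are orthogonal for [rip], so Pythagoras gives the squared norm of [X], and
    [(a + b) ^+ 2 <= 2 * (a ^+ 2 + b ^+ 2)] gives the bound. *)
Lemma cartesian_decomposition (X : M) : exists A B : M,
  [/\ adjmx A = A, adjmx B = B, X = A + 'i%C *: B &
      schatten2 A + schatten2 B <= Num.sqrt 2 * schatten2 X].
Proof.
pose h : R[i] := (2^-1 : R)%:C.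
have hh : h + h = 1 by rewrite /h -rmorphD /= -[2^-1]div1r -splitr.
have conj_h : Num.conj h = h by exact: conjc_real.
have conj_ih : Num.conj (- ('i%C * h)) = 'i%C * h.
  by apply/eqP; rewrite eq_complex /=; apply/andP; split; apply/eqP; ring.
pose A := h *: (X + adjmx X); pose B := (- ('i%C * h)) *: (X - adjmx X).
have hA : adjmx A = A by rewrite adjmxZ adjmxD adjmxK conj_h addrC.
have hB : adjmx B = B.
  rewrite /B adjmxZ adjmxD -(scaleN1r (adjmx X)) adjmxZ adjmxK rmorphN1.
  by rewrite !scaleN1r conj_ih -opprB scalerN scaleNr.
have XE : X = A + 'i%C *: B.
  rewrite /A /B scalerA mulrN mulrA -expr2 sqr_i mulN1r opprK -scalerDr.
  by rewrite addrACA subrr addr0 scalerDr -scalerDl hh scale1r.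
clearbody A B.
(* The adjoint preserves [rip] and fixes [A] but negates ['i%C *: B], so this inner product equals
   its own opposite. *)
have AB0 : rip A ('i%C *: B) = 0.
  have := rip_adj A ('i%C *: B); rewrite hA adjmxZ hB conj_i scaleNr ripC ripNl ripC.
  by move=> ?; lra.
exists A, B; split=> //.
have norm2 : schatten2 X ^+ 2 = schatten2 A ^+ 2 + schatten2 B ^+ 2.
  have <- : schatten2 ('i%C *: B) = schatten2 B := schatten2_phase B conj_i_mul.
  rewrite !schatten2_sqr XE; set D := 'i%C *: B in AB0 *.
  by rewrite ripDl !(ripC _ (A + D)) !ripDl (ripC D A) AB0 addr0 add0r.
have [A0 B0] := (schatten2_ge0 A, schatten2_ge0 B).
rewrite -[schatten2 X]ger0_norm ?schatten2_ge0 // -sqrtr_sqr -sqrtrM // norm2.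
rewrite -[X in X <= _]ger0_norm ?addr_ge0 // -sqrtr_sqr ler_wsqrtr //.
have := sqr_ge0 (schatten2 A - schatten2 B); lra.
Qed.

(** Pair [T X] with itself and split both [X] and [T X] into cartesian parts: four hermitian
    pairings appear, with phases absorbed in [w]. Each splitting costs [Num.sqrt 2], hence the
    factor 2. *)
Lemma schatten2_le_of_hermitian (T : {linear M -> M}) (K : R) : 0 <= K ->
  (forall (w : R[i]) (X Y : M), Num.conj w * w = 1 ->
     adjmx X = X -> adjmx Y = Y ->
     rip (w *: T X) Y <= K * (schatten2 X * schatten2 Y)) ->
  forall X, schatten2 (T X) <= 2 * K * schatten2 X.
Proof.
move=> K0 TK X; set Y := T X.
have := schatten2_ge0 Y; rewrite le_eqVlt => /orP[/eqP <-|Y0].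
  by rewrite !mulr_ge0 // schatten2_ge0.
rewrite -(ler_pM2r Y0) -expr2 schatten2_sqr.
have [A [B [hA hB XE leX]]] := cartesian_decomposition X.
have [C [D [hC hD YE leY]]] := cartesian_decomposition Y.
have w1 : Num.conj (1 : R[i]) * 1 = 1 by rewrite conjC1 mulr1.
have wi := conj_i_mul.
have wN : Num.conj (- 'i%C : R[i]) * (- 'i%C) = 1.
  by rewrite rmorphN mulrNN conj_i_mul.
have -> : rip Y Y = rip (1 *: T A) C + rip ('i%C *: T B) C
                    + rip (- 'i%C *: T A) D + rip (1 *: T B) D.
  have YX : Y = T A + 'i%C *: T B by rewrite /Y XE linearD linearZ.
  have iY : - 'i%C *: Y = - 'i%C *: T A + T B.
    by rewrite YX scalerDr scalerA mulNr -[_ * _]/('i%C ^+ 2) sqr_i opprK scale1r.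
  rewrite {2}YE ripC ripDl 2!(ripC _ Y) rip_i iY {1}YX !scale1r.
  have e1 := ripDl (T A) ('i%C *: T B) C.
  have e2 := ripDl (- 'i%C *: T A) (T B) D.
  by apply: etrans (congr2 +%R e1 e2) _; exact: addrA.
have := TK _ _ _ w1 hA hC; have := TK _ _ _ wi hB hC.
have := TK _ _ _ wN hA hD; have := TK _ _ _ w1 hB hD.
move=> l1 l2 l3 l4; apply: le_trans (lerD (lerD (lerD l4 l3) l2) l1) _.
rewrite -!mulrDr.
have -> : schatten2 A * schatten2 C + schatten2 B * schatten2 C
    + schatten2 A * schatten2 D + schatten2 B * schatten2 D
  = (schatten2 A + schatten2 B) * (schatten2 C + schatten2 D) by ring.
have := ler_pM (addr_ge0 (schatten2_ge0 A) (schatten2_ge0 B))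
  (addr_ge0 (schatten2_ge0 C) (schatten2_ge0 D)) leX leY.
move=> /(ler_wpM2l K0) /le_trans; apply.
have s2 : Num.sqrt 2 ^+ 2 = 2 :> R by rewrite sqr_sqrtr.
have -> : K * (Num.sqrt 2 * schatten2 X * (Num.sqrt 2 * schatten2 Y))
  = K * Num.sqrt 2 ^+ 2 * schatten2 X * schatten2 Y by ring.
by rewrite s2 (mulrC K).
Qed.
End Polarization.

(** Taking [s] to be the ratio of the norms of [Y] and [X] turns both squares into the product of
    the norms. *)
Lemma rip_le_of_scaling (R : realType) (N : nat) (T : {linear 'M[R[i]]_N -> 'M[R[i]]_N})
    (w : R[i]) (X Y : 'M[R[i]]_N) (u v k : R) :
  (forall s, 0 < s -> rip (w *: T X) Y <=
     s * u * schatten2 X ^+ 2 + s^-1 * v * schatten2 Y ^+ 2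
     + k * (schatten2 X * schatten2 Y)) ->
  rip (w *: T X) Y <= (u + v + k) * (schatten2 X * schatten2 Y).
Proof.
move=> le_s; have [->|/schatten2_gt0 X0] := eqVneq X 0.
  by rewrite linear0 scaler0 schatten2_0 mul0r mulr0 /rip mulmx0 mxtrace0.
have [->|/schatten2_gt0 Y0] := eqVneq Y 0.
  by rewrite ripC schatten2_0 !mulr0 /rip mulmx0 mxtrace0.
apply: le_trans (le_s (schatten2 Y / schatten2 X) (divr_gt0 Y0 X0)) _.
rewrite le_eqVlt; apply/orP; left; apply/eqP.
by field; rewrite !lt0r_neq0.
Qed.

(** * Numerical constants and conclusion *)

Lemma ln2_gt (R : realType) : 5 / 8 < ln (2 : R).
Proof.
(* Summing this for [m] from 4 to 7 gives [ln 8 - ln 4 >= 1/5 + 1/6 + 1/7 + 1/8 > 5/8]. *)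
have step (m : nat) : (0 < m)%N -> m.+1%:R^-1 <= ln (m.+1%:R : R) - ln m%:R.
  move=> m0; rewrite -opprB -ln_div ?posrE ?ltr0n // lerNr.
  have -> : m%:R / m.+1%:R = 1 + - m.+1%:R^-1 :> R.
    by rewrite -natr1; field; rewrite natr1 pnatr_eq0.
  by rewrite le_ln1Dx // ltrN2 invf_lt1 ?ltr0n // ltr1n.
have s5 : 5^-1 <= ln (5 : R) - ln 4 := step 4 isT.
have s6 : 6^-1 <= ln (6 : R) - ln 5 := step 5 isT.
have s7 : 7^-1 <= ln (7 : R) - ln 6 := step 6 isT.
have s8 : 8^-1 <= ln (8 : R) - ln 7 := step 7 isT.
have l8 : ln (8 : R) = ln 2 + ln 4.
  by rewrite -lnM ?posrE // -natrM.
lra.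
Qed.

(** Here [H] stands for the squared height and [n] is the least exponent with [200 * H <= 2 ^+ n].
    The constants 200 and 6/5 are those for which the final estimate closes. *)
Lemma dyadic_count (R : realType) (H : R) : 4^-1 <= H ->
  exists2 n : nat, 200 * H <= 2 ^+ n &
    0 < 4 * ln (48 * H) + 2 /\
    2 * n%:R < (6 / 5) ^+ 2 * (4 * ln (48 * H) + 2).
Proof.
move=> H4; set l := ln (48 * H); set u := ln (2 : R).
have u58 : 5 / 8 < u := ln2_gt R.
have H0 : 0 < H by lra.
(* Since [48 * H >= 12] and [2 ^+ 7 = 128 <= 144 = 12 ^+ 2]. *)
have lu : 7 * u <= 2 * l.
  rewrite /u /l !mulr_natl -!lnXn; try lra.
  rewrite ler_ln ?posrE ?exprn_gt0 //; try lra.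
  apply: le_trans (_ : 12 ^+ 2 <= _); last by rewrite lerXn2r ?nnegrE; lra.
  by rewrite -!natrX ler_nat.
have ex_n : exists n, 200 * H <= 2 ^+ n.
  exists (Num.bound (200 * H)); apply: ltW.
  apply: lt_le_trans (archi_boundP _) _; first by lra.
  by rewrite -natrX ler_nat ltnW // ltn_expl.
have [n nP n_min] := ex_minnP ex_n.
exists n => //; split; first by lra.
case: n nP n_min => [|n] nP n_min; first by lra.
have lt_n : 2 ^+ n < 200 * H.
  by rewrite ltNge; apply/negP => /n_min; rewrite ltnn.
(* Minimality of the exponent [n.+1] gives [2 ^+ n < 200 * H], and 200 is less than
   [2 ^+ 3 * 48]. *)
have : n%:R * u < 3 * u + l.
  have H48 : 0 < 48 * H by lra.
  rewrite /u /l (mulr_natl (ln 2) n) (mulr_natl (ln 2) 3) -!lnXn //.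
  rewrite -lnM ?posrE ?exprn_gt0 // ltr_ln ?posrE ?mulr_gt0 ?exprn_gt0 //.
  by apply: lt_trans lt_n _; rewrite -natrX mulrA ltr_pM2r // -natrM ltr_nat.
rewrite -natr1; set m := n%:R => lt_m.
nra.
Qed.

Theorem theorem4p1 (R : realType) (N : nat) (T : {linear 'M[R[i]]_N -> 'M[R[i]]_N}) :
  (0 < N)%N ->
  (exists X : 'M[R[i]]_N, T X != 0) ->
  exists P : 'M[R[i]]_N,
    [/\ P != 0, P *m P = P, adjmx P = P &
      opnorm (@schatten2 R N) T
        / (8 * Num.sqrt (4 * ln (48 * height T ^+ 2) + 2))
      < schatten2 (T P) / schatten2 P <= opnorm (@schatten2 R N) T].
Proof.
move=> N0 [X0 TX0].
have X0n : X0 != 0 by apply: contraNneq TX0 => ->; rewrite linear0.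
have N1 : 1 <= N%:R :> R by rewrite ler1n.
have N0' : 0 <= N%:R :> R by rewrite ler0n.
have id2 (X : 'M[R[i]]_N) : schatten2 X <= 1 * schatten2 X by rewrite mul1r.
have leInf (X : 'M[R[i]]_N) : schattenInf X <= N%:R * schatten2 X.
  by apply: le_trans (schattenInf_le_schatten2 X) _; rewrite ler_peMl ?schatten2_ge0.
have le1 (X : 'M[R[i]]_N) : schatten2 X <= N%:R * schatten1 X.
  by apply: le_trans (schatten2_le_schatten1 X) _; rewrite ler_peMl ?schatten1_ge0.
have T2 := opnorm_bound T ler01 (@schatten2_ge0 R N) id2 id2.
have T1 := opnorm_bound T N0' (@schatten1_ge0 R N) (@schatten1_le_schatten2 R N) le1.
have TI := opnorm_bound T N0' (@schattenInf_ge0 R N) leInf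
  (@schatten2_le_schattenInf R N).
have M0 := opnorm_gt0 ler01 (@schatten2_ge0 R N) id2 id2 TX0.
have al0 := opnorm_gt0 N0' (@schatten1_ge0 R N) (@schatten1_le_schatten2 R N) le1 TX0.
have be0 := opnorm_gt0 N0' (@schattenInf_ge0 R N) leInf
  (@schatten2_le_schattenInf R N) TX0.
have M_le := opnorm_le ler01 id2 X0n (T := T).
rewrite /height; move: T2 T1 TI M0 al0 be0 M_le.
set M := opnorm (@schatten2 R N) T; set al := opnorm _ T; set be := opnorm _ T.
clearbody M al be => T2 T1 TI M0 al0 be0 M_le.
have abE : Num.sqrt (al * be) ^+ 2 = al * be by rewrite sqr_sqrtr // ltW // mulr_gt0.
(* The Schur test on hermitian pairs, followed by polarization, gives [M <= 2 * sab], that is,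
   height at least 1/2. *)
have h4 : 4^-1 <= (Num.sqrt (al * be) / M) ^+ 2.
  pose sab := Num.sqrt (al * be).
  have sab0 : 0 < sab by rewrite sqrtr_gt0 mulr_gt0.
  have : M <= 2 * sab.
    apply: M_le; apply: schatten2_le_of_hermitian; first exact: ltW.
    move=> w X Y w1 hX hY.
    have -> : sab = sab / 2 + sab / 2 + 0 by lra.
    apply: rip_le_of_scaling => s s0; rewrite mul0r addr0.
    (* This parameter gives both quadratic terms the coefficient [sab / 2], because
       [sab ^+ 2 = al * be]. *)
    have t0 : 0 < s * (sab / al) by rewrite mulr_gt0 // divr_gt0.
    apply: le_trans (hermitian_schur w1 (ltW be0) T1 TI t0 hX hY) _.
    have aE : s * (sab / al) / 2 * al = s * (sab / 2).
      by field; rewrite lt0r_neq0.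
    have bE : (s * (sab / al))^-1 / 2 * be = s^-1 * (sab / 2).
      have -> : be = sab ^+ 2 / al.
        by rewrite abE mulrAC divff ?mul1r // lt0r_neq0.
      by field; rewrite !lt0r_neq0.
    by rewrite aE bE.
  move=> M_sab; have half : 2^-1 <= sab / M by rewrite ler_pdivlMr //; lra.
  have -> : 4^-1 = 2^-1 ^+ 2 :> R by field.
  by rewrite lerXn2r ?nnegrE ?invr_ge0 // divr_ge0 ?ltW.
have HE : (Num.sqrt (al * be) / M) ^+ 2 = al * be / M ^+ 2.
  by rewrite expr_div_n abE.
rewrite HE in h4 *.
have [n n200 [L0 nL]] := dyadic_count h4.
set L := 4 * ln _ + 2 in L0 nL *.
set c := M / _.
have sL0 : 0 < Num.sqrt L by rewrite sqrtr_gt0.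
have c0 : 0 <= c by rewrite ltW // divr_gt0 // mulr_gt0.
apply: contrapT => noP.
(* The upper bound holds for every projection by [T2], so the absence of a suitable [P] means
   failure of the lower bound on all of them. *)
have TP (P : 'M[R[i]]_N) : P *m P = P -> adjmx P = P ->
    schatten2 (T P) <= c * schatten2 P.
  move=> PP aP; have [->|P0] := eqVneq P 0.
    by rewrite linear0 schatten2_0 mulr0.
  have sP0 := schatten2_gt0 P0.
  rewrite leNgt; apply/negP => ltP; apply: noP; exists P; split=> //.
  by rewrite ltr_pdivlMr // ltP ler_pdivrMr // T2.
pose K := M / 10 + M / 10 + c * (2 * Num.sqrt 2) * Num.sqrt n%:R.
have K0 : 0 <= K.
  rewrite !addr_ge0 ?divr_ge0 ?(ltW M0) // mulr_ge0 ?sqrtr_ge0 // mulr_ge0 //.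
  by rewrite mulr_ge0 // sqrtr_ge0.
have : M <= 2 * K.
  apply: M_le; apply: schatten2_le_of_hermitian => // w X Y w1 hX hY.
  apply: rip_le_of_scaling => s s0.
  (* Each far contribution becomes [M / 10]; then [p * q = M ^+ 2 / (100 * al * be)], so the window
     condition reads [200 * H <= 2 ^+ n] with [H] the squared height. *)
  pose p := s * (M / 10 / al); pose q := s^-1 * (M / 10 / be).
  have p0 : 0 < p by rewrite mulr_gt0 // divr_gt0 // divr_gt0.
  have q0 : 0 < q by rewrite mulr_gt0 ?invr_gt0 // divr_gt0 // divr_gt0.
  have pqn : 2 <= p * q * 2 ^+ n.
    have -> : p * q * 2 ^+ n = 2 ^+ n / (100 * (al * be / M ^+ 2)).
      by rewrite /p /q; field; rewrite !lt0r_neq0.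
    rewrite ler_pdivlMr; first by lra.
    by rewrite mulr_gt0 // divr_gt0 ?mulr_gt0 ?exprn_gt0.
  apply: le_trans (hermitian_bound w1 (ltW be0) c0 T1 TI TP p0 q0 pqn hX hY) _.
  have pE : p * al = s * (M / 10) by rewrite /p; field; rewrite lt0r_neq0.
  have qE : q * be = s^-1 * (M / 10) by rewrite /q; field; rewrite !lt0r_neq0.
  by rewrite pE qE.
apply/negP; rewrite -ltNge.
(* In [2 * K] the far terms give [2/5 * M] and the near term is less than
   [2 * (M / 4) * (6/5) = 3/5 * M], so [2 * K < M]. *)
have lt_sqrt : Num.sqrt 2 * Num.sqrt n%:R < 6 / 5 * Num.sqrt L.
  rewrite -sqrtrM // -[6 / 5]ger0_norm ?divr_ge0 // -sqrtr_sqr -sqrtrM ?sqr_ge0 //.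
  by rewrite ltr_sqrt // (le_lt_trans _ nL) // mulr_ge0.
have cE : c * (2 * Num.sqrt 2) * Num.sqrt n%:R
    = M / 4 * (Num.sqrt 2 * Num.sqrt n%:R / Num.sqrt L).
  by rewrite /c; field; rewrite lt0r_neq0.
have : Num.sqrt 2 * Num.sqrt n%:R / Num.sqrt L < 6 / 5 by rewrite ltr_pdivrMr.
rewrite /K cE; nra.
Qed.
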